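(* Let $A$ be a set and let $T=\mathcal{TC}(A)$ be its transitive closure. Then $\mathcal{SP}(T)$ is a subset-friendly set with $A\in\mathcal{SP}(T)$. Moreover, $\mathcal{SP}(T)$ is the smallest subset-friendly set $U$ with $A\in U$, i.e. $$\mathcal{SP}(T)=\bigcap\{\,U : A\in U \text{ and } U \text{ is a subset-friendly set}\,\}.$$
   Context: All sets are pure sets (no urelements) satisfying the principle of regularity (every nonempty set $U$ has a member $Y$ with $U\cap Y=\emptyset$); the background theory is ZFC. For a set $A$, $\bigcup A=\{C:\exists B\in A,\ C\in B\}$ and $\mathcal{P}(A)=\{B:B\subseteq A\}$. Put $\cup^0(A)=A$, $\cup^{n}(A)=\bigcup(\cup^{n-1}(A))$, $\mathcal{P}^0(A)=A$, $\mathcal{P}^n(A)=\mathcal{P}(\mathcal{P}^{n-1}(A))$ for $n\ge 1$, and $$\mathcal{TC}(A)=\bigcup_{n=0}^\infty \cup^n(A),\qquad \mathcal{SP}(A)=\bigcup_{n=0}^\infty \mathcal{P}^n(A).$$ For a nonempty set or proper class $\mathcal K$ of sets, $\bigcap\mathcal K=\{C: C\in B\text{ for all }B\in\mathcal K\}$. A set $U$ is transitive iff $Y\subseteq U$ for all $Y\in U$. A set $U$ is subset-friendly iff: (1) $\emptyset\in U$; (2) $U$ is transitive; (3) for all $Y\in U$, $\mathcal{P}(Y)\in U$; (4) for all $Y,Z\in U$ there is a transitive set $V\in U$ with $\{Y,Z\}\subseteq V$. *)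

(* Defs.v *)
From Stdlib Require Import ClassicalEpsilon FunctionalExtensionality PropExtensionality.

Set Implicit Arguments.

(** [Ens] is Aczel's type of well-founded trees; a tree stands for the set of
    (the sets denoted by) its immediate subtrees.  [ZFset] is its quotient by
    extensional equality [Eq], so that equality of sets is Leibniz equality.
    The axioms of ZFC, with Separation and Replacement for arbitrary
    predicates, are proved below ([ext], [regularity], [mem_upair],
    [mem_sep], [mem_union], [mem_powerset], [infinity], [replacement], [choice]). *)

Inductive Ens : Type := sup : forall I : Type, (I -> Ens) -> Ens.

Fixpoint Eq (x y : Ens) : Prop :=
  match x, y with
  | sup f, sup g =>
      (forall a, exists b, Eq (f a) (g b)) /\ (forall b, exists a, Eq (f a) (g b))
  end.

Lemma Eq_refl x : Eq x x.
Proof. induction x as [I f IH]; simpl; split; intros a; exists a; apply IH. Qed.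

Lemma Eq_sym x : forall y, Eq x y -> Eq y x.
Proof.
induction x as [I f IH]; intros [J g]; simpl; intros [H1 H2]; split.
- intros b; destruct (H2 b) as [a Ha]; exists a; auto.
- intros a; destruct (H1 a) as [b Hb]; exists b; auto.
Qed.

Lemma Eq_trans x : forall y z, Eq x y -> Eq y z -> Eq x z.
Proof.
induction x as [I f IH]; intros [J g] [K h]; simpl; intros [H1 H2] [H3 H4]; split.
- intros a; destruct (H1 a) as [b Hb]; destruct (H3 b) as [c Hc]; exists c; eauto.
- intros c; destruct (H4 c) as [b Hb]; destruct (H2 b) as [a Ha]; exists a; eauto.
Qed.

Definition canon (x : Ens) : Ens := epsilon (inhabits x) (Eq x).

Lemma Eq_canon x : Eq x (canon x).
Proof. exact (epsilon_spec (inhabits x) (Eq x) (ex_intro _ x (Eq_refl x))). Qed.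

Lemma canon_eq x y : Eq x y -> canon x = canon y.
Proof.
intros H; unfold canon.
assert (E : Eq x = Eq y).
{ apply functional_extensionality; intros z; apply propositional_extensionality.
  split; intros Hz; eapply Eq_trans; eauto using Eq_sym. }
rewrite E; f_equal; apply proof_irrelevance.
Qed.

Record ZFset : Type := { repr : Ens; repr_canon : canon repr = repr }.

Lemma canon_idem x : canon (canon x) = canon x.
Proof. symmetry; apply canon_eq, Eq_canon. Qed.

Definition class_of (x : Ens) : ZFset := {| repr := canon x; repr_canon := canon_idem x |}.

Lemma repr_inj A B : repr A = repr B -> A = B.
Proof.
destruct A as [x hx], B as [y hy]; simpl; intros E; subst y; f_equal; apply proof_irrelevance.
Qed.

Lemma class_of_eq x y : Eq x y <-> class_of x = class_of y.
Proof.
split; intros H.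
- apply repr_inj, canon_eq, H.
- apply (f_equal repr) in H; simpl in H.
  apply Eq_trans with (canon x); [apply Eq_canon|].
  rewrite H; apply Eq_sym, Eq_canon.
Qed.

Lemma class_of_repr A : class_of (repr A) = A.
Proof. apply repr_inj; simpl; apply repr_canon. Qed.

Definition dom (x : Ens) : Type := match x return Type with @sup X _ => X end.
Definition sub (x : Ens) : dom x -> Ens := match x with sup f => f end.
Arguments sub : clear implicits.

(** [A] is the set of all [elt A i] with [i : idx A]. *)
Definition idx (A : ZFset) : Type := dom (repr A).
Definition elt (A : ZFset) (i : idx A) : ZFset := class_of (sub (repr A) i).

Definition mem (x A : ZFset) : Prop := exists i, elt A i = x.

Declare Scope zf_scope.
Open Scope zf_scope.
Notation "x ∈ A" := (mem x A) (at level 70, no associativity) : zf_scope.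

Definition subset (A B : ZFset) : Prop := forall x, x ∈ A -> x ∈ B.
Notation "A ⊆ B" := (subset A B) (at level 70, no associativity) : zf_scope.

Lemma mem_class_of I (f : I -> Ens) x :
  x ∈ class_of (sup f) <-> exists i, class_of (f i) = x.
Proof.
assert (H := Eq_canon (sup f)); revert H.
unfold mem, elt, idx; simpl; destruct (canon (sup f)) as [J g]; simpl; intros [H1 H2].
split.
- intros [j Hj]; destruct (H2 j) as [i Hi]; exists i.
  rewrite <- Hj; apply class_of_eq, Hi.
- intros [i Hi]; destruct (H1 i) as [j Hj]; exists j.
  rewrite <- Hi; apply class_of_eq, Eq_sym, Hj.
Qed.

Theorem ext A B : (forall x, x ∈ A <-> x ∈ B) -> A = B.
Proof.
intros H; rewrite <- (class_of_repr A), <- (class_of_repr B).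
rewrite <- (class_of_repr A), <- (class_of_repr B) in H; apply class_of_eq.
destruct (repr A) as [I f], (repr B) as [J g]; simpl; split.
- intros a; destruct (H (class_of (f a))) as [H1 _].
  destruct (proj1 (mem_class_of g _) (H1 (proj2 (mem_class_of f _) (ex_intro _ a eq_refl))))
    as [b Hb].
  exists b; apply class_of_eq; auto.
- intros b; destruct (H (class_of (g b))) as [_ H1].
  destruct (proj1 (mem_class_of f _) (H1 (proj2 (mem_class_of g _) (ex_intro _ b eq_refl))))
    as [a Ha].
  exists a; apply class_of_eq; auto.
Qed.

Theorem mem_ind (P : ZFset -> Prop) :
  (forall A, (forall x, x ∈ A -> P x) -> P A) -> forall A, P A.
Proof.
intros H A; rewrite <- (class_of_repr A); induction (repr A) as [I f IH].
apply H; intros x Hx; rewrite mem_class_of in Hx; destruct Hx as [i <-]; apply IH.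
Qed.

Definition family (I : Type) (F : I -> ZFset) : ZFset := class_of (sup (fun i => repr (F i))).

Lemma mem_family I (F : I -> ZFset) x : x ∈ family F <-> exists i, F i = x.
Proof.
unfold family; rewrite mem_class_of.
split; intros [i <-]; exists i; now rewrite class_of_repr.
Qed.

Definition empty : ZFset := family (fun i : False => match i with end).
Notation "∅" := empty : zf_scope.

Lemma mem_empty x : ~ x ∈ ∅.
Proof. unfold empty; rewrite mem_family; intros [[] _]. Qed.

Definition upair (Y Z : ZFset) : ZFset := family (fun b : bool => if b then Y else Z).

Lemma mem_upair x Y Z : x ∈ upair Y Z <-> x = Y \/ x = Z.
Proof.
unfold upair; rewrite mem_family; split.
- intros [[] <-]; auto.
- intros [->| ->]; [exists true | exists false]; auto.
Qed.

Definition sep (A : ZFset) (P : ZFset -> Prop) : ZFset :=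
  family (fun i : {i : idx A | P (elt A i)} => elt A (proj1_sig i)).

Lemma mem_sep x A P : x ∈ sep A P <-> x ∈ A /\ P x.
Proof.
unfold sep; rewrite mem_family; split.
- intros [[i Hi] <-]; simpl; split; [now exists i | auto].
- intros [[i <-] Hi]; now exists (exist _ i Hi).
Qed.

Definition union (A : ZFset) : ZFset :=
  family (fun p : {i : idx A & idx (elt A i)} => elt (elt A (projT1 p)) (projT2 p)).

Lemma mem_union C A : C ∈ union A <-> exists B, B ∈ A /\ C ∈ B.
Proof.
unfold union; rewrite mem_family; split.
- intros [[i j] <-]; simpl; exists (elt A i); split; [now exists i | now exists j].
- intros [B [[i <-] [j <-]]]; now exists (existT _ i j).
Qed.

Definition powerset (A : ZFset) : ZFset :=
  family (fun Q : idx A -> Prop => family (fun i : {i | Q i} => elt A (proj1_sig i))).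

Lemma mem_powerset B A : B ∈ powerset A <-> B ⊆ A.
Proof.
unfold powerset; rewrite mem_family; split.
- intros [Q <-] x Hx; rewrite mem_family in Hx; destruct Hx as [[i Hi] <-]; now exists i.
- intros H; exists (fun i => elt A i ∈ B); apply ext; intros x; rewrite mem_family; split.
  + intros [[i Hi] <-]; exact Hi.
  + intros Hx; destruct (H x Hx) as [i Hi].
    assert (Hi' : elt A i ∈ B) by (rewrite Hi; exact Hx).
    now exists (exist (fun i => elt A i ∈ B) i Hi').
Qed.

Definition union_nat (F : nat -> ZFset) : ZFset := union (family F).

Lemma mem_union_nat x F : x ∈ union_nat F <-> exists n, x ∈ F n.
Proof.
unfold union_nat; rewrite mem_union; split.
- intros [B [HB Hx]]; rewrite mem_family in HB; destruct HB as [n <-]; now exists n.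
- intros [n Hn]; exists (F n); split; auto; apply mem_family; now exists n.
Qed.

(** The intersection of a nonempty class [K] of sets, cut out of some member
    of [K]; see [mem_bigcap].  The value for empty [K] is junk. *)
Definition bigcap (K : ZFset -> Prop) : ZFset :=
  sep (epsilon (inhabits ∅) K) (fun C => forall B, K B -> C ∈ B).

Lemma mem_bigcap K C : (exists B, K B) -> (C ∈ bigcap K <-> forall B, K B -> C ∈ B).
Proof.
intros HK; unfold bigcap; rewrite mem_sep; split; [tauto|].
intros H; split; auto; apply H, epsilon_spec, HK.
Qed.

Theorem regularity U : (exists x, x ∈ U) -> exists Y, Y ∈ U /\ forall x, ~ (x ∈ U /\ x ∈ Y).
Proof.
intros [x Hx]; apply NNPP; intros N; revert x Hx.
apply (mem_ind (fun x => ~ x ∈ U)); intros x IH Hx; apply N; exists x; split; auto.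
intros y [Hy1 Hy2]; exact (IH y Hy2 Hy1).
Qed.

Theorem infinity :
  exists W, ∅ ∈ W /\ forall x, x ∈ W -> union (upair x (upair x x)) ∈ W.
Proof.
exists (family (fix F (n : nat) :=
  match n with O => ∅ | S k => union (upair (F k) (upair (F k) (F k))) end)).
split.
- apply mem_family; now exists 0.
- intros x Hx; rewrite mem_family in Hx; destruct Hx as [n <-].
  apply mem_family; now exists (S n).
Qed.

Theorem replacement A (R : ZFset -> ZFset -> Prop) :
  (forall x, x ∈ A -> exists! y, R x y) ->
  exists B, forall y, y ∈ B <-> exists x, x ∈ A /\ R x y.
Proof.
intros H.
assert (S : forall i, R (elt A i) (epsilon (inhabits ∅) (R (elt A i)))).
{ intros i; apply epsilon_spec; destruct (H (elt A i)) as [y [Hy _]]; [now exists i | now exists y]. }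
exists (family (fun i => epsilon (inhabits ∅) (R (elt A i)))); intros y.
rewrite mem_family; split.
- intros [i <-]; exists (elt A i); split; [now exists i | apply S].
- intros [x [[i <-] Hy]]; exists i.
  destruct (H (elt A i)) as [z [_ Hz]]; [now exists i|].
  transitivity z; [symmetry; apply Hz, S | apply Hz, Hy].
Qed.

Theorem choice A :
  (forall x, x ∈ A -> exists y, y ∈ x) ->
  (forall x x' y, x ∈ A -> x' ∈ A -> y ∈ x -> y ∈ x' -> x = x') ->
  exists C, forall x, x ∈ A -> exists! y, y ∈ x /\ y ∈ C.
Proof.
intros ne dj.
pose (c x := epsilon (inhabits ∅) (fun y => y ∈ x)).
assert (Hc : forall x, x ∈ A -> c x ∈ x).
{ intros x Hx; unfold c; apply epsilon_spec with (P := fun y => y ∈ x); auto. }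
exists (family (fun i => c (elt A i))); intros x Hx; exists (c x); split.
- split; auto; apply mem_family; destruct Hx as [i <-]; now exists i.
- intros y [Hy HyC]; rewrite mem_family in HyC; destruct HyC as [i <-].
  assert (Hi : elt A i ∈ A) by now exists i.
  now rewrite (dj x (elt A i) (c (elt A i)) Hx Hi Hy (Hc _ Hi)).
Qed.

Fixpoint cup_iter (n : nat) (A : ZFset) : ZFset :=
  match n with O => A | S k => union (cup_iter k A) end.

Fixpoint pow_iter (n : nat) (A : ZFset) : ZFset :=
  match n with O => A | S k => powerset (pow_iter k A) end.

Definition TC (A : ZFset) : ZFset := union_nat (fun n => cup_iter n A).

Definition SP (A : ZFset) : ZFset := union_nat (fun n => pow_iter n A).

Definition transitive (U : ZFset) : Prop := forall Y, Y ∈ U -> Y ⊆ U.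

Definition subset_friendly (U : ZFset) : Prop :=
  ∅ ∈ U /\
  transitive U /\
  (forall Y, Y ∈ U -> powerset Y ∈ U) /\
  (forall Y Z, Y ∈ U -> Z ∈ U ->
     exists V, V ∈ U /\ transitive V /\ upair Y Z ⊆ V).

(* Main.v *)
Require Import Defs.
From Stdlib Require Import PeanoNat.

(** Let [T = TC A].  Since [T] is transitive, [T ⊆ powerset T], so the sets
    [pow_iter n T] form an increasing chain of transitive sets, each of which is
    a member of the next ([pow_iter_transitive], [pow_iter_le]).  Hence finitely
    many members of [SP T] always lie in a common stage, which is itself a
    transitive member of [SP T]: this stage is the witness for the last clause
    of subset-friendliness ([SP_subset_friendly]).

    Conversely, let [U] be subset-friendly with [A ∈ U].  The last clause,
    applied to the pair [A], [A], bounds [A] by a transitive [V ∈ U]; then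
    [T ⊆ V], so [T ∈ powerset V ∈ U], and [T ∈ U] because [U] is transitive.
    Closure under power sets puts every stage [pow_iter n T] in [U], and
    transitivity of [U] gives [SP T ⊆ U] ([SP_TC_least]).  As [SP T] belongs to
    the class being intersected, it is the intersection. *)

Lemma subset_TC A : A ⊆ TC A.
Proof. intros x Hx; apply mem_union_nat; now exists 0. Qed.

Lemma TC_transitive A : transitive (TC A).
Proof.
intros Y HY x Hx; apply mem_union_nat in HY as [n Hn].
apply mem_union_nat; exists (S n); apply mem_union; now exists Y.
Qed.

Lemma TC_least A V : transitive V -> A ⊆ V -> TC A ⊆ V.
Proof.
intros HV HA x Hx; apply mem_union_nat in Hx as [n Hn]; revert x Hn.
induction n as [|n IH]; simpl; [exact HA|].
intros x Hx; apply mem_union in Hx as [B [HB Hx]]; exact (HV B (IH B HB) x Hx).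
Qed.

Lemma powerset_mono A B : A ⊆ B -> powerset A ⊆ powerset B.
Proof. intros H x Hx; apply mem_powerset in Hx; apply mem_powerset; intros y Hy; auto. Qed.

Lemma powerset_transitive T : transitive T -> transitive (powerset T).
Proof.
intros HT Y HY x Hx; apply mem_powerset in HY; apply mem_powerset.
apply HT, HY, Hx.
Qed.

Lemma pow_iter_transitive T n : transitive T -> transitive (pow_iter n T).
Proof. intros HT; induction n; simpl; auto using powerset_transitive. Qed.

(** A transitive set is included in its power set, and every stage is transitive. *)
Lemma pow_iter_le T m n : transitive T -> m <= n -> pow_iter m T ⊆ pow_iter n T.
Proof.
intros HT H; induction H as [|n _ IH]; intros x Hx; [exact Hx|].
apply mem_powerset, (pow_iter_transitive T n HT), IH, Hx.
Qed.

Lemma mem_SP_of_subset T B n : B ⊆ pow_iter n T -> B ∈ SP T.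
Proof. intros H; apply mem_union_nat; exists (S n); now apply mem_powerset. Qed.

Lemma SP_subset_friendly T : transitive T -> subset_friendly (SP T).
Proof.
intros HT; repeat split.
- apply (mem_SP_of_subset T _ 0); intros x Hx; destruct (mem_empty Hx).
- intros Y HY x Hx; apply mem_union_nat in HY as [n Hn].
  apply mem_union_nat; exists n; exact (pow_iter_transitive T n HT Y Hn x Hx).
- intros Y HY; apply mem_union_nat in HY as [n Hn].
  apply (mem_SP_of_subset T _ (S n)), powerset_mono.
  exact (pow_iter_transitive T n HT Y Hn).
- intros Y Z HY HZ.
  apply mem_union_nat in HY as [m Hm]; apply mem_union_nat in HZ as [n Hn].
  exists (pow_iter (Nat.max m n) T); repeat split.
  + apply (mem_SP_of_subset T _ (Nat.max m n)); intros x Hx; exact Hx.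
  + now apply pow_iter_transitive.
  + intros x Hx; apply mem_upair in Hx as [-> | ->].
    * exact (pow_iter_le T _ _ HT (Nat.le_max_l m n) _ Hm).
    * exact (pow_iter_le T _ _ HT (Nat.le_max_r m n) _ Hn).
Qed.

Lemma SP_least T U :
  transitive U -> (forall Y, Y ∈ U -> powerset Y ∈ U) -> T ∈ U -> SP T ⊆ U.
Proof.
intros HU HP HT x Hx; apply mem_union_nat in Hx as [n Hn].
(* The stages are shown to be members of [U], not just subsets: this is what
   closure under power sets propagates. *)
assert (Hstage : pow_iter n T ∈ U) by (clear Hn; induction n; simpl; auto).
exact (HU _ Hstage x Hn).
Qed.

(** The transitive bound of the pair [A], [A] includes [TC A]; its power set
    then brings [TC A] itself into [U]. *)
Lemma TC_mem_subset_friendly A U : subset_friendly U -> A ∈ U -> TC A ∈ U.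
Proof.
intros (_ & HU & HP & Hpair) HA.
destruct (Hpair A A HA HA) as (V & HVU & HV & HAV).
apply (HU (powerset V) (HP V HVU)), mem_powerset, TC_least; [exact HV|].
apply HV, HAV, mem_upair; now left.
Qed.

Lemma SP_TC_least A U : subset_friendly U -> A ∈ U -> SP (TC A) ⊆ U.
Proof.
intros HU HA; assert (HT := TC_mem_subset_friendly A U HU HA).
destruct HU as (_ & HU & HP & _); now apply SP_least.
Qed.

Theorem theorem2p5 (A : ZFset) :
  subset_friendly (SP (TC A)) /\
  A ∈ SP (TC A) /\
  SP (TC A) = bigcap (fun U => A ∈ U /\ subset_friendly U).
Proof.
assert (HS : subset_friendly (SP (TC A))) by apply SP_subset_friendly, TC_transitive.
assert (HA : A ∈ SP (TC A)) by apply (mem_SP_of_subset (TC A) A 0), subset_TC.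
split; [exact HS | split; [exact HA|]].
apply ext; intros C; rewrite mem_bigcap by (exists (SP (TC A)); auto); split.
- intros HC U [HAU HU]; exact (SP_TC_least A U HU HAU C HC).
- intros H; apply H; auto.
Qed.
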